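(* For every integer $k\ge 1$, $$b_k=2k-1+2\sum_{i\ge 1}\left\lfloor\frac{2k-1}{3^i}\right\rfloor 5^{i-1}.$$
   Context: For a positive integer $n$, $g_n=\sum_{i=1}^n\binom{n}{i}\binom{2n-2i}{n-i}$. $\{b_k\}_{k\ge 1}$ denotes the set of all positive integers $n$, listed in increasing order $b_1<b_2<\cdots$, for which $g_n$ is not divisible by 5. The sum has only finitely many nonzero terms. *)

(* Defs.v *)
From mathcomp Require Import all_boot.
From mathcomp Require Import classical_sets fsbigop.

Set Implicit Arguments.
Unset Strict Implicit.
Unset Printing Implicit Defensive.

Local Open Scope classical_set_scope.

Definition g (n : nat) : nat :=
  \sum_(1 <= i < n.+1) 'C(n, i) * 'C(2 * n - 2 * i, n - i).

Definition nondiv5 : set nat := [set n | 0 < n /\ ~~ (5 %| g n)].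

(* The listing is indexed from 1; the value b 0 is unconstrained. *)
Definition increasing_listing (A : set nat) (b : nat -> nat) : Prop :=
  (forall k l : nat, 0 < k -> k < l -> b k < b l) /\
  b @` [set k | 0 < k] = A.

(* Main.v *)
Require Import Defs.
From mathcomp Require Import all_boot.
From mathcomp Require Import classical_sets fsbigop.
From mathcomp Require Import all_algebra.
From mathcomp Require Import zify ring.

Local Open Scope classical_set_scope.

(** Write c(n) for the central binomial coefficient C(2n, n), and [x^n]P for
    the coefficient of x^n in P.  Adding the term i = 0 to the sum g(n) gives

      g(n) + c(n) = sum_j C(n, j) c(j) = [x^n] (x + (1 + x)^2)^n,

    and x + (1 + x)^2 = x^2 + 3x + 1 is congruent to (x - 1)^2 modulo 5.  Hence
    g(n) + c(n) is congruent to [x^n] (x - 1)^(2n) = (-1)^n c(n), so g(n) is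
    congruent to ((-1)^n - 1) c(n): it is divisible by 5 exactly when n is even
    or 5 divides c(n) ([dvd5_g]).

    By Lucas' theorem ([lucas_bin]), c is multiplicative along base-p digits
    modulo a prime p ([cbin_digit]).  Since c(0), ..., c(4) are
    1, 2, 6, 20, 70, the prime 5 fails to divide c(n) exactly when all the
    base-5 digits of n are at most 2.  Such n are the values of the map phi
    ([base3to5]) that writes t in base 3 and reads the digits in base 5.  The
    i-th base-3 digit of t is floor(t / 3^i) - 3 floor(t / 3^(i+1)), and summing
    these against 5^i gives

      phi(t) = t + 2 sum_(i >= 1) floor(t / 3^i) 5^(i-1).

    This closed form shows that phi is strictly increasing and preserves parity.
    The n with g(n) prime to 5 are therefore the phi(t) with t odd, and they are
    listed in increasing order by k |-> phi(2k - 1). *)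

Lemma eqn_modM d a b a' b' :
  a = a' %[mod d] -> b = b' %[mod d] -> a * b = a' * b' %[mod d].
Proof. by move=> ea eb; rewrite -modnMm ea eb modnMm. Qed.

Lemma eqn_modD d a b a' b' :
  a = a' %[mod d] -> b = b' %[mod d] -> a + b = a' + b' %[mod d].
Proof. by move=> ea eb; rewrite -modnDm ea eb modnDm. Qed.

(** In Vandermonde's expansion of C(p + n, _), every term carries a factor
    C(p, j), and only j = 0 and j = p survive modulo p.  The lower index p + m
    keeps both terms; in [bin_primeD_small] it is too small for j = p. *)
Lemma bin_primeD p n m : prime p ->
  'C(p + n, p + m) = 'C(n, p + m) + 'C(n, m) %[mod p].
Proof.
move=> p_pr; have p_gt0 := prime_gt0 p_pr.
rewrite -binomial.Vandermonde big_ord_recl bin0 mul1n subn0; apply: eqn_modD => //.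
have lt_pm : p.-1 < p + m by lia.
rewrite (bigD1 (Ordinal lt_pm)) //= /bump add1n prednK // binn mul1n.
rewrite addKn -[in RHS](addn0 'C(n, m)); apply: eqn_modD => //.
rewrite mod0n; apply/eqP/dvdn_sum => i; rewrite -val_eqE /= => ne_ip.
rewrite /bump add1n; have [lt_ip | le_pi] := ltnP i.+1 p.
  by rewrite dvdn_mulr // prime_dvd_bin.
by rewrite bin_small ?mul0n //; lia.
Qed.

Lemma bin_primeD_small p n m : prime p -> m < p ->
  'C(p + n, m) = 'C(n, m) %[mod p].
Proof.
move=> p_pr lt_mp.
rewrite -binomial.Vandermonde big_ord_recl bin0 mul1n subn0.
rewrite -[in RHS](addn0 'C(n, m)); apply: eqn_modD => //.
rewrite mod0n; apply/eqP/dvdn_sum => i _; rewrite dvdn_mulr //.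
by rewrite prime_dvd_bin //= /bump; have := ltn_ord i; lia.
Qed.

(** One digit step of Lucas' theorem.  Modulo p, adding p to the upper index
    acts on the leading parts n, m by Pascal's rule, so induction on n
    suffices. *)
Lemma lucas_bin p n m a b : prime p -> a < p -> b < p ->
  'C(p * n + a, p * m + b) = 'C(n, m) * 'C(a, b) %[mod p].
Proof.
move=> p_pr lt_ap lt_bp; elim: n m => [|n IHn] [|m].
- by rewrite !muln0 bin0 mul1n.
- by rewrite muln0 bin_small ?bin0n //; nia.
- rewrite mulnS -addnA muln0 add0n bin_primeD_small //.
  by have := IHn 0; rewrite muln0 add0n !bin0.
- rewrite !mulnS -!addnA bin_primeD // binS mulnDl.
  apply: eqn_modD => //.
  by have := IHn m.+1; rewrite mulnS -addnA.
Qed.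

Definition cbin n := 'C(2 * n, n).

(** If 2r < p, doubling p q + r has no carry out of the low digit and this is
    Lucas.  Otherwise the low digit of 2r is 2r - p < r, so both sides vanish
    modulo p. *)
Lemma cbin_digit p q r : prime p -> r < p ->
  cbin (p * q + r) = cbin q * cbin r %[mod p].
Proof.
move=> p_pr lt_rp; rewrite /cbin.
have [lt_2rp | le_p2r] := ltnP (2 * r) p.
  have -> : 2 * (p * q + r) = p * (2 * q) + 2 * r by ring.
  exact: lucas_bin.
have [d def_2r lt_dr] : exists2 d, 2 * r = p * 1 + d & d < r.
  by exists (2 * r - p); lia.
have -> : 2 * (p * q + r) = p * (2 * q).+1 + d.
  by rewrite mulnDr def_2r; ring.
have lt_dp := ltn_trans lt_dr lt_rp.
have cbin_r0 : 'C(2 * r, r) = 0 %[mod p].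
  have := lucas_bin p 1 0 d r p_pr lt_dp lt_rp.
  by rewrite muln0 add0n -def_2r (bin_small lt_dr) muln0.
by rewrite lucas_bin // (bin_small lt_dr) -[in RHS]modnMmr cbin_r0 mod0n !muln0.
Qed.

(** The missing term i = 0 of g is c(n); reversing the sum, j = n - i, turns
    C(2n - 2i, n - i) into c(j). *)
Lemma gE n : g n + cbin n = \sum_(j < n.+1) 'C(n, j) * cbin j.
Proof.
rewrite -(big_mkord xpredT (fun j => 'C(n, j) * cbin j)) big_nat_rev /= add0n.
rewrite big_ltn // addnC subn1 binn mul1n; congr (_ + _).
rewrite /g [RHS]big_nat_cond [LHS]big_nat_cond; apply: eq_bigr => i.
rewrite andbT => /andP[_ le_in].
by rewrite /cbin subSS bin_sub // mulnBr.
Qed.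

Section CoefficientExtraction.
Import GRing.Theory.
Local Open Scope ring_scope.

Lemma coef_XaddC_exp (R : comNzRingType) (a : R) m k : (k <= m)%N ->
  (('X + a%:P) ^+ m)`_k = a ^+ (m - k) *+ 'C(m, k).
Proof.
move=> le_km; rewrite addrC exprDn coef_sum (bigD1 (Ordinal (le_km : (k < m.+1)%N))) //=.
rewrite coefMn -rmorphXn /= coefCM coefXn eqxx mulr1 big1 ?addr0 // => i.
rewrite -val_eqE /= => ne_ik.
by rewrite coefMn -rmorphXn /= coefCM coefXn eq_sym (negbTE ne_ik) mulr0 mul0rn.
Qed.

(** Compare the coefficients of X^n on the two sides of
    (X + (X + 1)^2)^n = (X - 1)^(2n), which holds in characteristic 5. *)
Lemma sum_bin_cbin_F5 n :
  (\sum_(j < n.+1) 'C(n, j) * cbin j)%N%:R = (-1) ^+ n * (cbin n)%:R :> 'F_5.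
Proof.
have sq : ('X + ('X + 1%:P) ^+ 2) = ('X + (-1)%:P) ^+ 2 :> {poly 'F_5}.
  (* The two sides of [sq] differ by 5 X. *)
  have e5 : (5%:R : {poly 'F_5}) = 0 by rewrite -polyC_natr; apply/eqP; rewrite polyC_eq0.
  apply/eqP; rewrite -subr_eq0 -[X in _ == X](mul0r 'X) -e5; apply/eqP.
  rewrite polyCN polyC1; ring.
have /(congr1 (fun p : {poly 'F_5} => (p ^+ n)`_n)) := sq.
rewrite -exprM coef_XaddC_exp ?leq_pmull //.
have -> : (2 * n - n = n)%N by lia.
rewrite mulr_natr => <-.
rewrite exprDn coef_sum natr_sum; apply: eq_bigr => j _.
have le_jn : (j <= n)%N by rewrite -ltnS.
rewrite coefMn -exprM coefXnM ltnNge leq_subr /= subKn //.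
by rewrite coef_XaddC_exp ?leq_pmull // expr1n mulnC mulrnA.
Qed.

Lemma dvd5_g n : (5 %| g n)%N = ~~ odd n || (5 %| cbin n)%N.
Proof.
have dvd5E m : (5 %| m)%N = (m%:R == 0 :> 'F_5).
  by rewrite (dvdn_pcharf (pchar_Fp (isT : prime 5))).
have := sum_bin_cbin_F5 n; rewrite -gE natrD -signr_odd => /(canRL (addrK _)).
rewrite !dvd5E => ->; case: (odd n) => /=; last by rewrite expr0 mul1r subrr eqxx.
by rewrite expr1 mulN1r -opprD oppr_eq0 -mulr2n -[_ *+ 2]mulr_natr mulf_eq0 orbC.
Qed.

End CoefficientExtraction.

(** Half of the correction term phi(t) - t.  The bound t is one of many that
    reach all the nonzero terms ([quot3_sum_widen]). *)
Definition quot3_sum t := \sum_(0 <= i < t) t %/ 3 ^ i.+1 * 5 ^ i.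

Definition base3to5 t := t + 2 * quot3_sum t.

Lemma quot3_sum_widen t N : t <= N ->
  \sum_(0 <= i < N) t %/ 3 ^ i.+1 * 5 ^ i = quot3_sum t.
Proof.
move=> le_tN; rewrite /quot3_sum (big_cat_nat (n := t)) //=.
rewrite -[RHS]addn0; congr (_ + _).
rewrite big_nat_cond big1 // => i /andP[/andP[le_ti _] _].
by rewrite divn_small //; have := ltn_expl i.+1 (isT : 1 < 3); lia.
Qed.

Lemma quot3_sum_digit q r : r < 3 ->
  quot3_sum (3 * q + r) = q + 5 * quot3_sum q.
Proof.
move=> lt_r3; have def_q : (3 * q + r) %/ 3 = q.
  by rewrite mulnC divnMDl // divn_small // addn0.
rewrite -(quot3_sum_widen (3 * q + r) (3 * q + r).+1) // big_nat_recl //.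
rewrite expn1 def_q expn0 muln1 -(quot3_sum_widen q (3 * q + r)); last by lia.
rewrite big_distrr /=; congr (_ + _); apply: eq_bigr => i _.
by rewrite [3 ^ _]expnS divnMA def_q [5 ^ _.+1]expnS mulnCA.
Qed.

(** This recursion says that [base3to5] reads in base 5 the base-3 digits
    of its argument. *)
Lemma base3to5_digit q r : r < 3 ->
  base3to5 (3 * q + r) = 5 * base3to5 q + r.
Proof. by move=> lt_r3; rewrite /base3to5 quot3_sum_digit //; lia. Qed.

Lemma quot3_sum_mono s t : s <= t -> quot3_sum s <= quot3_sum t.
Proof.
move=> le_st; rewrite -(quot3_sum_widen s t) //; apply: leq_sum => i _.
by rewrite leq_mul2r leq_div2r ?orbT.
Qed.

Lemma ltn_base3to5 s t : s < t -> base3to5 s < base3to5 t.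
Proof.
by move=> lt_st; have := quot3_sum_mono s t (ltnW lt_st); rewrite /base3to5; lia.
Qed.

Lemma odd_base3to5 t : odd (base3to5 t) = odd t.
Proof. by rewrite /base3to5 oddD oddM addbF. Qed.

(** Among c(0), ..., c(4) = 1, 2, 6, 20, 70, exactly the last two are
    multiples of 5. *)
Lemma dvd5_cbin_digit q r : r < 5 ->
  (5 %| cbin (5 * q + r)) = (5 %| cbin q) || (2 < r).
Proof.
move=> lt_r5; rewrite /dvdn (cbin_digit 5) // -/(5 %| _) Euclid_dvdM //.
by congr (_ || _); case: r lt_r5 => [|[|[|[|[|r]]]]].
Qed.

Lemma dvd5_cbin_base3to5 t : ~~ (5 %| cbin (base3to5 t)).
Proof.
elim/ltn_ind: t => -[_ | t IHt]; first by rewrite /base3to5 /quot3_sum big_geq.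
rewrite (divn_eq t.+1 3) [_ * 3]mulnC base3to5_digit ?ltn_mod //.
have lt_r3 : t.+1 %% 3 < 3 by rewrite ltn_mod.
rewrite dvd5_cbin_digit; last exact: leq_trans lt_r3 _.
by rewrite negb_or IHt ?ltn_Pdiv // -leqNgt.
Qed.

Lemma cbin_base3to5P n : ~~ (5 %| cbin n) -> exists t, base3to5 t = n.
Proof.
elim/ltn_ind: n => -[_ _ | n IHn].
  by exists 0; rewrite /base3to5 /quot3_sum big_geq.
rewrite {1}(divn_eq n.+1 5) [_ * 5]mulnC dvd5_cbin_digit ?ltn_mod //.
rewrite negb_or -leqNgt => /andP[/IHn []]; first by rewrite ltn_Pdiv.
move=> t def_t le_r2; exists (3 * t + n.+1 %% 5).
by rewrite base3to5_digit // def_t mulnC -divn_eq.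
Qed.

Lemma nondiv5P n : nondiv5 n <-> exists2 t, odd t & base3to5 t = n.
Proof.
rewrite /nondiv5 /= dvd5_g negb_or negbK; split.
  move=> [_ /andP[odd_n /cbin_base3to5P[t def_n]]].
  by exists t; rewrite // -odd_base3to5 def_n.
move=> [t odd_t <-]; rewrite odd_base3to5 odd_t dvd5_cbin_base3to5.
by split; rewrite // odd_gt0 // odd_base3to5.
Qed.

(** If two listings u, v of A agree before k, then u k occurs in v at some
    position j.  Here j < k would give u j = v j = u k, against strict
    monotonicity; so j >= k and v k <= u k.  Equality follows by symmetry. *)
Lemma increasing_listing_uniq (A : set nat) (b c : nat -> nat) :
  increasing_listing A b -> increasing_listing A c ->
  forall k, 0 < k -> b k = c k.
Proof.
move=> listb listc.
suff le_at (u v : nat -> nat) k : increasing_listing A u ->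
    increasing_listing A v -> 0 < k ->
    (forall j, 0 < j -> j < k -> u j = v j) -> v k <= u k.
  elim/ltn_ind=> k IHk k_gt0; apply/eqP.
  rewrite eqn_leq (le_at c b) ?(le_at b c) // => j j_gt0 lt_jk; first exact: IHk.
  by rewrite IHk.
move=> [u_incr u_im] [v_incr v_im] k_gt0 eq_uv.
have : A (u k) by rewrite -u_im; exists k.
rewrite -v_im => -[j /= j_gt0 def_uk]; rewrite -def_uk.
have [lt_jk | lt_kj | -> //] := ltngtP j k; last exact/ltnW/v_incr.
by have := u_incr j k j_gt0 lt_jk; rewrite eq_uv // def_uk ltnn.
Qed.

Lemma increasing_listing_base3to5 :
  increasing_listing nondiv5 (fun k => base3to5 (2 * k - 1)).
Proof.
split=> [k l k_gt0 lt_kl | ]; first by apply: ltn_base3to5; lia.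
apply/seteqP; split=> [n [k /= k_gt0 <-] | n /nondiv5P[t odd_t <-]].
  apply/nondiv5P; exists (2 * k - 1) => //.
  by rewrite oddB ?oddM //; lia.
exists t./2.+1 => //=; congr base3to5.
by have := odd_double_half t; rewrite odd_t; lia.
Qed.

(** The terms with i > t vanish because t < 3^t, so the sum over all i >= 1 is
    the finite one with its index shifted by 1. *)
Lemma fsum_quot3 t :
  \big[addn/0]_(i \in [set i : nat | 1 <= i]) (t %/ 3 ^ i * 5 ^ (i - 1))
  = quot3_sum t.
Proof.
rewrite (fsbigE (index_iota 1 t.+1)) ?iota_uniq //; first last.
- move=> i /= i_gt0; rewrite mem_index_iota i_gt0 /= -leqNgt => lt_ti.
  by rewrite divn_small //; have := ltn_expl i (isT : 1 < 3); lia.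
- by move=> i /=; rewrite mem_index_iota => /andP[].
rewrite big_add1 /=.
rewrite /quot3_sum; under eq_bigl do rewrite mem_set //.
by apply: eq_bigr => i _; rewrite subn1.
Qed.

Theorem corollary2p1 :
  (exists b : nat -> nat, increasing_listing nondiv5 b) /\
  forall b : nat -> nat, increasing_listing nondiv5 b ->
  forall k : nat, 1 <= k ->
    b k = 2 * k - 1 +
      2 * \big[addn/0]_(i \in [set i : nat | 1 <= i])
            ((2 * k - 1) %/ 3 ^ i * 5 ^ (i - 1)).
Proof.
split=> [|b listb k k_gt0].
  by exists (fun k => base3to5 (2 * k - 1)); exact: increasing_listing_base3to5.
rewrite fsum_quot3.
by rewrite (increasing_listing_uniq _ _ _ listb increasing_listing_base3to5).
Qed.
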